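(* Suppose $\Theta$ is a metric space and that $\theta\mapsto r(\theta,\delta)$ is continuous on $\Theta$ for every $\delta\in\mathcal D$. Let $\delta_0\in\mathcal D$ and $\mathcal C\subseteq\mathcal D$. If there exists $\epsilon\in{}^*\mathbb R$, $\epsilon>0$, such that ${}^*\delta_0$ is $\epsilon$-${}^*$Bayes among $\mathcal C^{*}=\{{}^*\delta:\delta\in\mathcal C\}$ with respect to an $\epsilon$-regular nonstandard prior, then $\delta_0$ is admissible among $\mathcal C$.
   Context: Statistical decision problem: a nonempty parameter space $\Theta$, here a metric space with metric $d$ and Borel $\sigma$-algebra $\mathcal B[\Theta]$; a measurable space $\mathbb A$ of actions; a loss $\ell:\Theta\times\mathbb A\to[0,\infty)$, measurable in the action; a measurable sample space $X$; probability measures $(P_\theta)_{\theta\in\Theta}$ on $X$. A (randomized) decision procedure is a map $\delta$ from $X$ to the probability measures on $\mathbb A$, with $\delta(x,A):=(\delta(x))(A)$, such that $x\mapsto\int_{\mathbb A}\ell(\theta,a)\,\delta(x,da)$ is measurable for every $\theta$. Its risk is $r(\theta,\delta)=\int_X\big[\int_{\mathbb A}\ell(\theta,a)\,\delta(x,da)\big]P_\theta(dx)$. $\mathcal D$ is the set of decision procedures with $r(\theta,\delta)<\infty$ for all $\theta$. $\delta\in\mathcal D$ is admissible among $\mathcal C\subseteq\mathcal D$ if there is no $\delta'\in\mathcal C$ with $r(\theta,\delta')\le r(\theta,\delta)$ for all $\theta\in\Theta$ and $r(\theta,\delta')\ne r(\theta,\delta)$ for some $\theta\in\Theta$. Nonstandard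 setting: work in a nonstandard extension ${}^*$ of a superstructure over a ground set containing $\mathbb R\cup\Theta\cup\mathbb A\cup X$, with ${}^*s=s$ for elements $s$ of the ground set, satisfying transfer and as much saturation as necessary. The risk extends to ${}^*r:{}^*\Theta\times{}^*\mathcal D\to{}^*\mathbb R$. For $x,y\in{}^*\mathbb R$, $x\gg y$ means $\gamma x>y$ for every standard real $\gamma>0$. A nonstandard prior $\Pi$ is an internal probability measure on $({}^*\Theta,{}^*\mathcal B[\Theta])$. The internal Bayes risk is ${}^*r(\Pi,\Delta)=\int{}^*r(\theta,\Delta)\,\Pi(d\theta)$ (internal integral, with value in ${}^*[0,\infty]$). For $\epsilon\in{}^*[0,\infty)$ and $\mathcal E\subseteq{}^*\mathcal D$, $\Delta\in{}^*\mathcal D$ is $\epsilon$-${}^*$Bayes among $\mathcal E$ with respect to $\Pi$ if ${}^*r(\Pi,\Delta)\in{}^*\mathbb R$ and ${}^*r(\Pi,\Delta)\le{}^*r(\Pi,\Delta')+\epsilon$ for all $\Delta'\in\mathcal E$. A nonstandard prior $\pi$ is $\epsilon$-regular if $\pi(\{t\in{}^*\Theta:{}^*d(t,\theta_0)<\rho\})\gg\epsilon$ for every $\theta_0\in\Theta$ and every non-infinitesimal $\rho>0$. *)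

(* Defs.v *)
From HB Require Import structures.
From mathcomp Require Import all_boot all_order all_algebra.
From mathcomp Require Import all_classical all_reals all_analysis.
From mathcomp Require Import measurable_realfun.

Set Implicit Arguments.
Unset Strict Implicit.
Unset Printing Implicit Defensive.

Import Order.TTheory GRing.Theory Num.Theory.
Import numFieldNormedType.Exports.

Local Open Scope classical_set_scope.
Local Open Scope ring_scope.

(** * Statistical decision problems *)

(* Nonempty metric spaces, with distance [mdist]. *)
#[short(type="pmetricType")]
HB.structure Definition PointedMetric (K : numDomainType) :=
  {T of Metric K T & isPointed T}.

Definition borel (R : realType) (Theta : pmetricType R) :=
  g_sigma_algebraType (@open Theta).

Record decision_problem (R : realType) (Theta : pmetricType R)
    (dA dX : measure_display) (A : measurableType dA) (X : measurableType dX) :=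
  DecisionProblem {
    loss : Theta -> A -> R ;
    loss_ge0 : forall t a, 0 <= loss t a ;
    measurable_loss : forall t, measurable_fun [set: A] (loss t) ;
    model : Theta -> probability X R }.

Section decision_procedures.
Context (R : realType) (Theta : pmetricType R) (dA dX : measure_display)
  (A : measurableType dA) (X : measurableType dX)
  (pb : decision_problem Theta A X).
Implicit Types (delta : X -> probability A R) (t : Theta).

Definition expected_loss t delta (x : X) : \bar R :=
  (\int[delta x]_(a in [set: A]) (loss pb t a)%:E)%E.

Definition decision_procedure delta : Prop :=
  forall t, measurable_fun [set: X] (expected_loss t delta).

Definition risk t delta : \bar R :=
  (\int[model pb t]_(x in [set: X]) expected_loss t delta x)%E.

Definition finite_risk : set (X -> probability A R) :=
  [set delta | decision_procedure delta /\
               forall t, (risk t delta < +oo)%E].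

Definition admissible (C : set (X -> probability A R)) delta : Prop :=
  ~ exists delta', [/\ C delta',
      forall t, (risk t delta' <= risk t delta)%E &
      exists t, risk t delta' != risk t delta].

End decision_procedures.

(** * Superstructures and nonstandard extensions *)

(* The cumulative levels V_0 = atoms, V_(n+1) = V_n `|` P(V_n), relative to a
   membership relation [mem]. *)
Fixpoint vlevel (V : Type) (mem : V -> V -> Prop) (atoms : set V) (n : nat)
    : set V :=
  if n is m.+1 then
    vlevel mem atoms m `|`
    [set x | ~ atoms x /\ forall y, mem y x -> vlevel mem atoms m y]
  else atoms.

(* The superstructure V(S), i.e. the union of the V_n(S), over the ground set S
   of urelements; the axioms determine it up to a unique isomorphism.
   [vset P] is the set with elements P when P is contained in some V_n(S), and
   is unspecified otherwise. *)
Record superstructure (S : Type) := Superstructure {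
  vcarrier :> Type ;
  vmem : vcarrier -> vcarrier -> Prop ;
  vatom : S -> vcarrier ;
  vset : set vcarrier -> vcarrier ;
  vatom_inj : injective vatom ;
  vmem_atom : forall x s, ~ vmem x (vatom s) ;
  vext : forall x y, ~ range vatom x -> ~ range vatom y ->
    (forall z, vmem z x <-> vmem z y) -> x = y ;
  vlevel_ex : forall x, exists n, vlevel vmem (range vatom) n x ;
  vset_natom : forall n P, P `<=` vlevel vmem (range vatom) n ->
    ~ range vatom (vset P) ;
  vmem_vset : forall n P, P `<=` vlevel vmem (range vatom) n ->
    forall x, vmem x (vset P) <-> P x }.

(* Formulas of set theory with bounded quantifiers, in de Bruijn notation:
   [BAll i f] is "for all x in v_i, f", where in [f] the variable 0 denotes x
   and k.+1 denotes the former k. *)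
Inductive bounded_formula : Type :=
  | BMem (i j : nat)
  | BEq (i j : nat)
  | BNot (f : bounded_formula)
  | BAnd (f g : bounded_formula)
  | BAll (i : nat) (f : bounded_formula).

Fixpoint bholds (S : Type) (V : superstructure S) (v : nat -> V)
    (f : bounded_formula) : Prop :=
  match f with
  | BMem i j => vmem (v i) (v j)
  | BEq i j => v i = v j
  | BNot f => ~ bholds v f
  | BAnd f g => bholds v f /\ bholds v g
  | BAll i f => forall x, vmem x (v i) ->
      bholds (fun k => if k is k'.+1 then v k' else x) f
  end.

(* [nsground] is *S, which contains S through [ns_incl].  Saturation is for
   families of internal sets (elements of some *y) indexed by the type K. *)
Record nonstandard_extension (S K : Type) := NonstandardExtension {
  stdv : superstructure S ;
  nsground : Type ;
  nsv : superstructure nsground ;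
  ns_incl : S -> nsground ;
  star : stdv -> nsv ;
  star_atom : forall s, star (vatom stdv s) = vatom nsv (ns_incl s) ;
  star_ground :
    star (vset (range (vatom stdv))) = vset (range (vatom nsv)) ;
  transfer : forall (f : bounded_formula) (v : nat -> stdv),
    bholds v f <-> bholds (fun k => star (v k)) f ;
  saturation : forall F : K -> nsv,
    (forall k, exists y, vmem (F k) (star y)) ->
    (forall J : set K, finite_set J ->
       exists x, forall k, J k -> vmem x (F k)) ->
    exists x, forall k, vmem x (F k) }.

(** * Coding a decision problem in the superstructure *)

Record ground (R Theta A X S : Type) := Ground {
  ground_real : R -> S ;
  ground_param : Theta -> S ;
  ground_act : A -> S ;
  ground_obs : X -> S ;
  ground_real_inj : injective ground_real ;
  ground_param_inj : injective ground_param ;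
  ground_act_inj : injective ground_act ;
  ground_obs_inj : injective ground_obs }.

Section set_theory.
Context (S : Type) (V : superstructure S).

(* Kuratowski pairs. *)
Definition vpair (x y : V) : V :=
  vset [set vset [set x]; vset [set x; y]].

Definition vgraph (P : set V) (f : V -> V) : V :=
  vset [set vpair x (f x) | x in P].

(* The value at x of a function given as a set of pairs. *)
Definition vapp (f x : V) : V :=
  xget (vset set0 : {classic V}) [set y | vmem (vpair x y) f].

End set_theory.

Section coding.
Context (R : realType) (Theta : pmetricType R) (dA dX : measure_display)
  (A : measurableType dA) (X : measurableType dX)
  (pb : decision_problem Theta A X)
  (S : Type) (G : ground R Theta A X S) (V : superstructure S).

Definition creal (r : R) : V := vatom V (ground_real G r).
Definition cparam (t : Theta) : V := vatom V (ground_param G t).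
Definition cact (a : A) : V := vatom V (ground_act G a).
Definition cobs (x : X) : V := vatom V (ground_obs G x).

(* Any two distinct non-atoms can represent the infinite values. *)
Definition cereal (x : \bar R) : V :=
  match x with
  | r%:E => creal r
  | +oo%E => vset set0
  | -oo%E => vset [set vset set0]
  end.

Definition creals : V := vset (range creal).
Definition cparams : V := vset (range cparam).

Definition crel (rel : \bar R -> \bar R -> Prop) : V :=
  vset [set z | exists x y, rel x y /\ z = vpair (cereal x) (cereal y)].

Definition cop (op : \bar R -> \bar R -> \bar R) : V :=
  vset [set z | exists x y,
    z = vpair (vpair (cereal x) (cereal y)) (cereal (op x y))].

Definition cdist : V :=
  vset [set z | exists s t,
    z = vpair (vpair (cparam s) (cparam t)) (creal (mdist s t))].

(* A probability measure is coded by its graph on the measurable sets only: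
   a Rocq measure also has values, without meaning, on the other sets. *)
Definition cprob (d : measure_display) (T : measurableType d) (c : T -> V)
    (mu : probability T R) : V :=
  vset [set vpair (vset (c @` B)) (creal (fine (mu B))) | B in measurable].

Definition cprior (mu : probability (borel Theta) R) : V :=
  @cprob _ (borel Theta) cparam mu.

Definition cpriors : V := vset (range cprior).

Definition cproc (delta : X -> probability A R) : V :=
  vset (range (fun x => vpair (cobs x) (cprob cact (delta x)))).

Definition cprocs : V := vset (cproc @` finite_risk pb).

Definition crisk : V :=
  vset [set z | exists t delta, finite_risk pb delta /\
    z = vpair (vpair (cparam t) (cproc delta)) (creal (fine (risk pb t delta)))].

Definition cfun (f : Theta -> R) : V :=
  vset (range (fun t => vpair (cparam t) (creal (f t)))).

(* The operator taking a nonnegative Borel function f and a probability measure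
   mu to the integral of f against mu, with values in [0, +oo]. *)
Definition cintegral : V :=
  vset [set z | exists (f : Theta -> R) (mu : probability (borel Theta) R),
    [/\ forall t, 0 <= f t,
        measurable_fun [set: borel Theta] (f : borel Theta -> R) &
        z = vpair (vpair (cfun f) (cprior mu))
              (cereal (\int[mu]_(t in [set: borel Theta]) (f t)%:E)%E)]].

End coding.

(** * Nonstandard Bayes procedures *)

Section nonstandard_bayes.
Context (R : realType) (Theta : pmetricType R) (dA dX : measure_display)
  (A : measurableType dA) (X : measurableType dX)
  (pb : decision_problem Theta A X)
  (S K : Type) (G : ground R Theta A X S) (E : nonstandard_extension S K).
Implicit Types x y z eps rho t Pi Delta : nsv E.

Definition ns_real x : Prop := vmem x (star (creals G (stdv E))).
Definition ns_std (r : R) : nsv E := star (creal G (stdv E) r).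

Definition ns_lt x y : Prop :=
  vmem (vpair x y) (star (crel G (stdv E) (fun a b => (a < b)%E))).
Definition ns_le x y : Prop :=
  vmem (vpair x y) (star (crel G (stdv E) (fun a b => (a <= b)%E))).
Definition ns_add x y : nsv E :=
  vapp (star (cop G (stdv E) (fun a b => (a + b)%E))) (vpair x y).
Definition ns_mul x y : nsv E :=
  vapp (star (cop G (stdv E) (fun a b => (a * b)%E))) (vpair x y).

Definition ns_infinitesimal x : Prop :=
  ns_real x /\
  forall c : R, 0 < c -> ns_lt (ns_std (- c)) x /\ ns_lt x (ns_std c).

Definition ns_much_greater x y : Prop :=
  forall c : R, 0 < c -> ns_lt y (ns_mul (ns_std c) x).

Definition ns_param t : Prop := vmem t (star (cparams G (stdv E))).
Definition ns_dist s t : nsv E := vapp (star (cdist G (stdv E))) (vpair s t).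

Definition ns_proc Delta : Prop := vmem Delta (star (cprocs pb G (stdv E))).
Definition ns_risk t Delta : nsv E :=
  vapp (star (crisk pb G (stdv E))) (vpair t Delta).

(* Internal probability measures on the internal Borel sets of *Theta. *)
Definition ns_prior Pi : Prop := vmem Pi (star (cpriors G (stdv E))).

Definition ns_integral f Pi : nsv E :=
  vapp (star (cintegral G (stdv E))) (vpair f Pi).

Definition ns_bayes_risk Pi Delta : nsv E :=
  ns_integral (vgraph [set t | ns_param t] (ns_risk^~ Delta)) Pi.

Definition ns_ball t0 rho : nsv E :=
  vset [set t | ns_param t /\ ns_lt (ns_dist t t0) rho].

Definition ns_bayes eps (Es : set (nsv E)) Pi Delta : Prop :=
  [/\ ns_proc Delta,
      ns_real (ns_bayes_risk Pi Delta) &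
      forall Delta', Es Delta' ->
        ns_le (ns_bayes_risk Pi Delta) (ns_add (ns_bayes_risk Pi Delta') eps)].

Definition ns_regular eps Pi : Prop :=
  forall (t0 : Theta) rho,
    ns_real rho -> ns_lt (ns_std 0) rho -> ~ ns_infinitesimal rho ->
    ns_much_greater (vapp Pi (ns_ball (star (cparam G (stdv E) t0)) rho)) eps.

Definition star_proc (delta : X -> probability A R) : nsv E :=
  star (cproc G (stdv E) delta).

End nonstandard_bayes.

(* Main.v *)
(** If [delta] in C dominates [delta0], continuity of the risks gives c, rho > 0
    such that the risk of [delta] is below that of [delta0] everywhere, and below
    it by c on the ball B of radius rho around some parameter.  Hence, for every
    prior P, the Bayes risk of [delta] plus c P(B) is at most that of [delta0].
    By transfer this holds for the nonstandard prior Pi and the extensions of the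
    two procedures.  If the extension of [delta0] is Bayes up to eps, then
    c Pi(B) <= eps, while eps-regularity says that eps < c Pi(B). *)
Require Import Defs.
From HB Require Import structures.
From mathcomp Require Import all_boot all_order all_algebra.
From mathcomp Require Import all_classical all_reals all_analysis.
From mathcomp Require Import measurable_realfun.
From mathcomp Require Import lra.

Set Implicit Arguments.
Unset Strict Implicit.
Unset Printing Implicit Defensive.

Import Order.TTheory GRing.Theory Num.Theory.
Import numFieldNormedType.Exports.

Local Open Scope classical_set_scope.
Local Open Scope ring_scope.

(** * Levels, sets and Kuratowski pairs in a superstructure *)

Section superstructure_theory.
Context (S : Type) (V : superstructure S).
Implicit Types (x y z : V) (P Q : set V).

Local Notation level := (vlevel (@vmem S V) (range (vatom V))).

Lemma vlevel_le m n x : (m <= n)%N -> level m x -> level n x.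
Proof.
elim: n => [|n IH]; first by rewrite leqn0 => /eqP ->.
by rewrite leq_eqVlt => /predU1P[-> //|mn /(IH mn)]; left.
Qed.

Lemma vmem_natom x y : vmem x y -> ~ range (vatom V) y.
Proof. by move=> xy [s _ sy]; apply: (@vmem_atom _ V x s); rewrite sy. Qed.

(** Each level is transitive: atoms have no members, and the members of a set added at level n+1
    already lie in level n. *)
Lemma vmem_vlevel n x y : vmem x y -> level n y -> level n x.
Proof.
move=> xy; elim: n => [[s _ sy]|n IH].
  by case: (vmem_natom xy); exists s.
by case=> [/IH xn|[_ /(_ _ xy) xn]]; apply: (vlevel_le (leqnSn n)).
Qed.

Lemma vlevel_vset n P : P `<=` level n -> level n.+1 (vset P).
Proof.
move=> Pn; right; split=> [|y]; first exact: vset_natom Pn.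
by move/(vmem_vset Pn)/Pn.
Qed.

Lemma vlevel_vset2 n x y : level n x -> level n y -> level n.+1 (vset [set x; y]).
Proof. by move=> xn yn; apply: vlevel_vset => _ [->|->]. Qed.

Lemma vlevel_vpair n x y : level n x -> level n y -> level n.+2 (vpair x y).
Proof.
move=> xn yn; apply: vlevel_vset2; last exact: vlevel_vset2.
by apply: vlevel_vset => _ ->.
Qed.

Lemma vset_inj n P Q : P `<=` level n -> Q `<=` level n -> vset P = vset Q -> P = Q.
Proof.
move=> Pn Qn PQ; apply/seteqP; split=> x.
  by move/(vmem_vset Pn); rewrite PQ => /(vmem_vset Qn).
by move/(vmem_vset Qn); rewrite -PQ => /(vmem_vset Pn).
Qed.

Lemma vlevel_ex2 x y : exists2 n, level n x & level n y.
Proof.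
have [m mx] := vlevel_ex x; have [n ny] := vlevel_ex y.
by exists (maxn m n); [apply: vlevel_le mx|apply: vlevel_le ny]; rewrite ?leq_maxl ?leq_maxr.
Qed.

Lemma vmem_vset1 x z : vmem z (vset [set x]) <-> z = x.
Proof.
have [n xn] := vlevel_ex x.
by apply: (iff_trans (@vmem_vset _ _ n _ _ z)) => // _ ->.
Qed.

Lemma vmem_vset2 x y z : vmem z (vset [set x; y]) <-> z = x \/ z = y.
Proof.
have [n xn yn] := vlevel_ex2 x y.
by apply: (iff_trans (@vmem_vset _ _ n _ _ z)) => // _ [->|->].
Qed.

(** A set and its members lie in a common level, where [vset] is specified and extensionality
    applies. This identifies sets given by comprehension in the extension with sets of the form
    [star y]. *)
Lemma vset_ext P z : ~ range (vatom V) z ->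
  (forall x, vmem x z <-> P x) -> vset P = z.
Proof.
move=> zN zP; have [n zn] := vlevel_ex z.
have Pn : P `<=` level n by move=> x /zP/vmem_vlevel; exact.
apply: vext => // [|x]; first exact: vset_natom Pn.
by rewrite (vmem_vset Pn) zP.
Qed.

Lemma vset1P x z : z = vset [set x] <-> vmem x z /\ forall w, vmem w z -> w = x.
Proof.
split=> [->|[xz zx]]; first by split=> [|w /vmem_vset1//]; apply/vmem_vset1.
apply/esym/vset_ext; first exact: vmem_natom xz.
by move=> w; split=> [/zx|->].
Qed.

Lemma vset2P x y z : z = vset [set x; y] <->
  [/\ vmem x z, vmem y z & forall w, vmem w z -> w = x \/ w = y].
Proof.
split=> [->|[xz yz zxy]].
  by split=> [||w /vmem_vset2//]; apply/vmem_vset2; [left|right].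
apply/esym/vset_ext; first exact: vmem_natom xz.
by move=> w; split=> [/zxy|[->|->]].
Qed.

(** All quantifiers are bounded by [z], as a bounded formula for pairs requires. *)
Lemma vpairP x y z : z = vpair x y <->
  exists a b, [/\ vmem a z, vmem b z, a = vset [set x], b = vset [set x; y] &
    forall w, vmem w z -> w = a \/ w = b].
Proof.
split=> [/vset2P[az bz zab]|[a [b [az bz aE bE zab]]]].
  by exists (vset [set x]), (vset [set x; y]).
by subst a b; apply/vset2P.
Qed.

Lemma vset1_inj x y : vset [set x] = vset [set y] -> x = y.
Proof. by move=> xy; apply/vmem_vset1; rewrite -xy; apply/vmem_vset1. Qed.

Lemma vset2_inj x y z : vset [set x; y] = vset [set x; z] -> y = z.
Proof.
move=> E.
have : vmem y (vset [set x; z]) by rewrite -E; apply/vmem_vset2; right.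
have : vmem z (vset [set x; y]) by rewrite E; apply/vmem_vset2; right.
by move=> /vmem_vset2[->|->] // /vmem_vset2[].
Qed.

Lemma vset12 x y z : vset [set x] = vset [set y; z] -> y = x /\ z = x.
Proof.
move=> E; have [[+ _] [+ _]] := (vmem_vset1 x y, vmem_vset1 x z).
by rewrite E => -> => [-> //|]; apply/vmem_vset2; [right|left].
Qed.

Lemma vpair_inj x y x' y' : vpair x y = vpair x' y' -> x = x' /\ y = y'.
Proof.
move=> E.
have xx' : x = x'.
  have : vmem (vset [set x]) (vpair x' y') by rewrite -E; apply/vmem_vset2; left.
  by move=> /vmem_vset2[/vset1_inj|/vset12[->]].
by move: E; rewrite -xx' => /vset2_inj/vset2_inj.
Qed.

(** Both components are members of a member of the pair, so quantifiers over them can be bounded by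
    the pair. *)
Lemma vpair_snd x y : exists2 u, vmem u (vpair x y) & vmem x u /\ vmem y u.
Proof.
by exists (vset [set x; y]); [|split]; apply/vmem_vset2; tauto.
Qed.

Lemma vapp_mem (f x y : V) : vmem (vpair x y) f -> vmem (vpair x (vapp f x)) f.
Proof. by move=> xyf; apply: (@xgetPex {classic V} _ [set y | vmem (vpair x y) f]); exists y. Qed.

End superstructure_theory.

(** * Bounded formulas and their semantics *)

Section bounded_formulas.
Implicit Types (f g : bounded_formula) (i j k a x y z F : nat).

Definition bor f g := BNot (BAnd (BNot f) (BNot g)).
Definition bimp f g := BNot (BAnd f (BNot g)).
Definition bex i f := BNot (BAll i (BNot f)).
Definition bset1 a x := BAnd (BMem x a) (BAll a (BEq 0 x.+1)).
Definition bset2 a x y :=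
  BAnd (BMem x a) (BAnd (BMem y a) (BAll a (bor (BEq 0 x.+1) (BEq 0 y.+1)))).
(** Under the two outer quantifiers, variable 1 is the singleton and variable 0 the unordered pair;
    the last quantifier shifts them to 2 and 1. *)
Definition bpair z x y := bex z (bex z.+1
  (BAnd (bset1 1 x.+2) (BAnd (bset2 0 x.+2 y.+2)
    (BAll z.+2 (bor (BEq 0 2) (BEq 0 1)))))).
Definition brel x y F := bex F (bpair 0 x.+1 y.+1).
(** The quantifiers run over w in [F], u in w and p in u, which become variables 2, 1 and 0; the
    matrix says p = (x, y) and w = (p, z). *)
Definition bapp x y z F :=
  bex F (bex 0 (bex 0 (BAnd (bpair 0 x.+3 y.+3) (bpair 2 0 z.+3)))).

Context (S : Type) (V : superstructure S).
Implicit Type v : nat -> V.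

(** The assignment that [bholds] builds at a quantifier, named so that formulas can be interpreted
    by rewriting. *)
Definition bcons (u : V) v k := if k is k'.+1 then v k' else u.

Local Arguments bholds : simpl never.

Lemma bmemE v i j : bholds v (BMem i j) = vmem (v i) (v j).
Proof. by []. Qed.

Lemma beqE v i j : bholds v (BEq i j) = (v i = v j).
Proof. by []. Qed.

Lemma bnotE v f : bholds v (BNot f) = ~ bholds v f.
Proof. by []. Qed.

Lemma bandE v f g : bholds v (BAnd f g) = (bholds v f /\ bholds v g).
Proof. by []. Qed.

Lemma ballE v i f :
  bholds v (BAll i f) = forall x : V, vmem x (v i) -> bholds (bcons x v) f.
Proof. by []. Qed.

Lemma borE v f g : bholds v (bor f g) = (bholds v f \/ bholds v g).
Proof.
apply/propext; change (~ (~ bholds v f /\ ~ bholds v g) <-> bholds v f \/ bholds v g).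
by have := pselect (bholds v f); have := pselect (bholds v g); tauto.
Qed.

Lemma bimpE v f g : bholds v (bimp f g) = (bholds v f -> bholds v g).
Proof.
apply/propext; change (~ (bholds v f /\ ~ bholds v g) <-> (bholds v f -> bholds v g)).
by have := pselect (bholds v g); tauto.
Qed.

Lemma bexE v i f :
  bholds v (bex i f) = exists x : V, vmem x (v i) /\ bholds (bcons x v) f.
Proof.
apply/propext; split=> [/existsNP[x /not_implyP[xi /contrapT]]|[x [xi fx]] /(_ x xi)//].
by exists x.
Qed.

Lemma bset1E v a x : bholds v (bset1 a x) = (v a = vset [set v x]).
Proof. by apply/propext; rewrite vset1P. Qed.

Lemma bset2E v a x y : bholds v (bset2 a x y) = (v a = vset [set v x; v y]).
Proof.
apply/propext; rewrite vset2P !bandE !bmemE ballE.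
split=> [[? [? H]]|[? ? H]]; split=> //; first by move=> w /H; rewrite borE.
by split=> // w /H; rewrite borE.
Qed.

Lemma bpairE v z x y : bholds v (bpair z x y) = (v z = vpair (v x) (v y)).
Proof.
apply/propext; rewrite vpairP bexE; split=> [[a [az]]|[a [b [az bz aE bE zab]]]].
  rewrite bexE => -[b [bz]]; rewrite bandE bset1E bandE bset2E ballE => -[aE [bE zab]].
  by exists a, b; split=> // w /zab; rewrite borE.
exists a; split=> //; rewrite bexE; exists b; split=> //.
rewrite bandE bset1E bandE bset2E ballE; do 2 split=> //.
by move=> w /zab; rewrite borE.
Qed.

Lemma brelE v x y F : bholds v (brel x y F) = vmem (vpair (v x) (v y)) (v F).
Proof.
apply/propext; rewrite bexE; split=> [[z [zF]]|xyF].
  by rewrite bpairE /= => <-.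
by exists (vpair (v x) (v y)); rewrite bpairE.
Qed.

Lemma bappE v x y z F :
  bholds v (bapp x y z F) = vmem (vpair (vpair (v x) (v y)) (v z)) (v F).
Proof.
apply/propext; rewrite bexE; split=> [[w [wF]]|wF].
  rewrite bexE => -[u [_]]; rewrite bexE => -[p [_]].
  by rewrite bandE !bpairE /= => -[<- <-].
have [u uw [pu _]] := vpair_snd (vpair (v x) (v y)) (v z).
exists (vpair (vpair (v x) (v y)) (v z)); split=> //; rewrite bexE.
exists u; split=> //; rewrite bexE.
by exists (vpair (v x) (v y)); split=> //; rewrite bandE !bpairE.
Qed.

End bounded_formulas.

Arguments bholds : simpl never.

(** * Binary functions as sets of pairs *)

Definition vfun2 (S : Type) (V : superstructure S) (F D1 D2 D3 : V) : Prop :=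
  forall x, vmem x D1 -> forall y, vmem y D2 -> exists z, vmem z D3 /\
    forall z', vmem (vpair (vpair x y) z') F <-> z' = z.

(** Uniqueness in [vfun2] ranges over the whole superstructure. It is bounded here because a value
    of [F] is a member of a member of a member of [F]. *)
Definition bfun2 : bounded_formula :=
  BAll 1 (BAll 3 (bex 5 (BAnd (bapp 2 1 0 3)
    (BAll 3 (BAll 0 (BAll 0 (bimp (bapp 5 4 0 6) (BEq 0 3)))))))).

Lemma bfun2E (S : Type) (V : superstructure S) (v : nat -> V) :
  bholds v bfun2 = vfun2 (v 0%N) (v 1%N) (v 2%N) (v 3%N).
Proof.
apply/propext; rewrite ballE; split=> H x xD; have := H x xD; clear H.
  rewrite ballE => H y yD; have := H y yD; rewrite bexE; clear H.
  move=> [z []] /=; rewrite bandE bappE /= => zD [xyz H].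
  exists z; split=> // z'; split=> [xyz'|-> //].
  have [u uw [_ zu]] := vpair_snd (vpair x y) z'.
  move: H; rewrite ballE => /(_ _ xyz').
  rewrite ballE => /(_ _ uw); rewrite ballE => /(_ _ zu).
  by rewrite bimpE bappE beqE /=; apply.
rewrite ballE => H y yD; have := H y yD; rewrite bexE; clear H.
move=> [z [zD zP]]; exists z; split=> //; rewrite bandE bappE /=.
split; first by apply/zP.
rewrite ballE => w _; rewrite ballE => u _; rewrite ballE => z' _.
by rewrite bimpE bappE beqE /= => /zP.
Qed.

(** [vapp] chooses some value, and functionality makes it the only one. Used on extensions of
    standard functions, this computes the operations of the extension. *)
Lemma vfun2_vapp (S : Type) (V : superstructure S) (F D1 D2 D3 x y : V) :
  vfun2 F D1 D2 D3 -> vmem x D1 -> vmem y D2 ->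
  vmem (vapp F (vpair x y)) D3 /\
  forall z, vmem (vpair (vpair x y) z) F <-> z = vapp F (vpair x y).
Proof.
move=> FD xD yD; have [z [zD zP]] := FD _ xD _ yD.
have /vapp_mem/zP -> : vmem (vpair (vpair x y) z) F by apply/zP.
by [].
Qed.

Section quantifier_congruence.
Context (S : Type) (V : superstructure S) (v : nat -> V).

Lemma eq_ball i f (P : V -> Prop) :
  (forall x, vmem x (v i) -> bholds (bcons x v) f = P x) ->
  bholds v (BAll i f) = forall x, vmem x (v i) -> P x.
Proof.
by move=> fP; rewrite ballE; apply: eq_forall => x; apply/propext; split=> + xi;
  move=> /(_ xi); rewrite (fP x xi).
Qed.

Lemma eq_bex i f (P : V -> Prop) :
  (forall x, vmem x (v i) -> bholds (bcons x v) f = P x) ->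
  bholds v (bex i f) = exists x, vmem x (v i) /\ P x.
Proof.
by move=> fP; rewrite bexE; apply/propext; split=> -[x [xi]];
  [rewrite fP// => Px|rewrite -fP// => Px]; exists x.
Qed.

End quantifier_congruence.

(** * Properties of coded objects that are transferred *)

Section transferred_properties.
Context (S : Type) (V : superstructure S).
Implicit Types (f F D P t lt le B : V).

(* [f] is the function t |-> F(t, d) from [D] to [D']. *)
Definition is_section f F D d D' : Prop :=
  (forall t, vmem t D -> forall r, vmem r D' ->
     vmem (vpair (vpair t d) r) F -> vmem (vpair t r) f) /\
  (forall z, vmem z f -> exists t, vmem t D /\ exists r, vmem r D' /\
     (z = vpair t r /\ vmem (vpair (vpair t d) r) F)).

(** The distance enters as a named value [d], because [vapp] is defined by choice and not by a
    bounded formula. *)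
Definition is_ball B P D dist t0 lt rho : Prop :=
  (forall t, vmem t B -> vmem t P) /\
  (forall t, vmem t P -> forall d, vmem d D ->
     vmem (vpair (vpair t t0) d) dist ->
     (vmem t B -> vmem (vpair d rho) lt) /\
     (vmem (vpair d rho) lt -> vmem t B)).

(** Uniqueness over all [b'] determines [vapp P B]; for priors and a ball this is the internal
    probability of the ball. *)
Definition evaluable Q B D : Prop :=
  forall P, vmem P Q -> exists b, vmem b D /\
    forall b', vmem (vpair B b') P <-> b' = b.

(* If e < c P(B), then f0 cannot be Bayes up to e against f1:
   int f0 dP <= int f1 dP + e fails.  All values are named by variables, so
   that transfer gives the statement about the operations of the extension. *)
Definition no_bayes f0 f1 B c Q Re Ere Int add mul lt le : Prop :=
  forall P, vmem P Q -> forall e, vmem e Re -> forall r0, vmem r0 Re ->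
  forall r1, vmem r1 Ere -> forall s, vmem s Ere -> forall b, vmem b Re ->
  forall m, vmem m Ere ->
  vmem (vpair (vpair f0 P) r0) Int -> vmem (vpair (vpair f1 P) r1) Int ->
  vmem (vpair (vpair r1 e) s) add -> vmem (vpair B b) P ->
  vmem (vpair (vpair c b) m) mul -> vmem (vpair e m) lt ->
  ~ vmem (vpair r0 s) le.

End transferred_properties.

(* The free variables 0, 1, ... are the arguments of the property, in order. *)
Definition bsection : bounded_formula :=
  BAnd (BAll 2 (BAll 5 (bimp (bapp 1 5 0 3) (brel 1 0 2))))
       (BAll 0 (bex 3 (bex 6 (BAnd (bpair 2 1 0) (bapp 1 6 0 4))))).

Definition bball : bounded_formula :=
  BAnd (BAll 0 (BMem 0 2))
       (BAll 1 (BAll 3 (bimp (bapp 1 6 0 5)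
         (BAnd (bimp (BMem 1 2) (brel 0 8 7)) (bimp (brel 0 8 7) (BMem 1 2)))))).

Definition bevaluable : bounded_formula :=
  BAll 0 (bex 3 (BAnd (brel 3 0 1)
    (BAll 1 (BAll 0 (BAll 0 (bimp (brel 6 0 4) (BEq 0 3))))))).

Definition bno_bayes : bounded_formula :=
  BAll 4 (BAll 6 (BAll 7 (BAll 9 (BAll 10 (BAll 10 (BAll 12
    (bimp (bapp 7 6 4 14) (bimp (bapp 8 6 3 14) (bimp (bapp 3 5 2 15)
      (bimp (brel 9 1 6) (bimp (bapp 10 1 0 16) (bimp (brel 5 0 17)
        (BNot (brel 4 2 18)))))))))))))).

Section formula_semantics.
Context (S : Type) (V : superstructure S) (v : nat -> V).

Lemma bsectionE : bholds v bsection =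
  is_section (v 0%N) (v 1%N) (v 2%N) (v 3%N) (v 4%N).
Proof.
rewrite bandE; congr (_ /\ _).
  by do 2 apply: eq_ball => ? _; rewrite bimpE bappE brelE.
by apply: eq_ball => ? _; do 2 apply: eq_bex => ? _; rewrite bandE bpairE bappE.
Qed.

Lemma bballE : bholds v bball =
  is_ball (v 0%N) (v 1%N) (v 2%N) (v 3%N) (v 4%N) (v 5%N) (v 6%N).
Proof.
rewrite bandE; congr (_ /\ _).
by do 2 apply: eq_ball => ? _; rewrite bimpE bappE bandE !bimpE !brelE.
Qed.

Lemma bevaluableE : bholds v bevaluable = evaluable (v 0%N) (v 1%N) (v 2%N).
Proof.
apply: eq_ball => P _; apply: eq_bex => b _; apply/propext.
rewrite bandE brelE /=; split=> [[Bb uniq] b'|bP].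
  split=> [Bb'|-> //]; have [u uw [_ b'u]] := vpair_snd (v 1%N) b'.
  move: uniq; rewrite ballE => /(_ _ Bb'); rewrite ballE => /(_ _ uw).
  by rewrite ballE => /(_ _ b'u); rewrite bimpE brelE beqE /=; apply.
split; first by apply/bP.
rewrite ballE => w _; rewrite ballE => u _; rewrite ballE => b' _.
by rewrite bimpE brelE beqE /= => /bP.
Qed.

Lemma bno_bayesE : bholds v bno_bayes =
  no_bayes (v 0%N) (v 1%N) (v 2%N) (v 3%N) (v 4%N) (v 5%N) (v 6%N) (v 7%N)
    (v 8%N) (v 9%N) (v 10%N) (v 11%N).
Proof.
by do 7 apply: eq_ball => ? _; rewrite !bimpE !bappE !brelE bnotE brelE.
Qed.

End formula_semantics.

(** * Transfer principles *)

Section transfer_principles.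
Context (S K : Type) (E : nonstandard_extension S K).
Implicit Types x y : stdv E.

(** The default [vset set0] goes only to variables beyond the list, which are not free in the
    formulas below. *)
Let env (s : seq (stdv E)) (k : nat) : stdv E := nth (vset set0) s k.

Lemma star_mem x y : vmem x y <-> vmem (star x) (star y).
Proof. exact: (transfer (BMem 0 1) (env [:: x; y])). Qed.

Lemma star_subset x y :
  (forall z, vmem z x -> vmem z y) -> forall z, vmem z (star x) -> vmem z (star y).
Proof. exact: (iffLR (transfer (BAll 0 (BMem 0 2)) (env [:: x; y]))). Qed.

Lemma star_vpair x y : star (vpair x y) = vpair (star x) (star y).
Proof.
have := transfer (bpair 0 1 2) (env [:: vpair x y; x; y]).
by rewrite !bpairE /= => -[+ _]; apply.
Qed.

(** By [star_ground], being an atom is membership in an extended set, and [star_mem] reflects it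
    back to the standard side. *)
Lemma star_natom x : ~ range (vatom (stdv E)) x -> ~ range (vatom (nsv E)) (star x).
Proof.
move=> xN; have sub (T : Type) (V : superstructure T) (z : V) :
    vmem z (vset (range (vatom V))) <-> range (vatom V) z.
  exact: (@vmem_vset _ _ 0).
by move/sub; rewrite -star_ground => /star_mem/sub.
Qed.

Lemma star_vfun2 F D1 D2 D3 :
  @vfun2 _ (stdv E) F D1 D2 D3 -> vfun2 (star F) (star D1) (star D2) (star D3).
Proof.
by have := transfer bfun2 (env [:: F; D1; D2; D3]); rewrite !bfun2E /= => ->.
Qed.

Lemma star_section f F D d D' : @is_section _ (stdv E) f F D d D' ->
  is_section (star f) (star F) (star D) (star d) (star D').
Proof.
by have := transfer bsection (env [:: f; F; D; d; D']); rewrite !bsectionE /= => ->.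
Qed.

Lemma star_ball B P D dist t0 lt rho : @is_ball _ (stdv E) B P D dist t0 lt rho ->
  is_ball (star B) (star P) (star D) (star dist) (star t0) (star lt) (star rho).
Proof.
by have := transfer bball (env [:: B; P; D; dist; t0; lt; rho]); rewrite !bballE /= => ->.
Qed.

Lemma star_evaluable Q B D : @evaluable _ (stdv E) Q B D ->
  evaluable (star Q) (star B) (star D).
Proof.
by have := transfer bevaluable (env [:: Q; B; D]); rewrite !bevaluableE /= => ->.
Qed.

Lemma star_no_bayes f0 f1 B c Q Re Ere Int add mul lt le :
  @no_bayes _ (stdv E) f0 f1 B c Q Re Ere Int add mul lt le ->
  no_bayes (star f0) (star f1) (star B) (star c) (star Q) (star Re) (star Ere)
    (star Int) (star add) (star mul) (star lt) (star le).
Proof.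
have := transfer bno_bayes (env [:: f0; f1; B; c; Q; Re; Ere; Int; add; mul; lt; le]).
by rewrite !bno_bayesE /= => ->.
Qed.

End transfer_principles.

(** * Codes of the objects of a decision problem *)

Section coding_theory.
Context (R : realType) (Theta : pmetricType R) (dA dX : measure_display)
  (A : measurableType dA) (X : measurableType dX)
  (pb : decision_problem Theta A X)
  (S : Type) (G : ground R Theta A X S) (V : superstructure S).

Local Notation level := (vlevel (@vmem S V) (range (vatom V))).
Local Notation creal := (creal G V).
Local Notation cparam := (cparam G V).
Local Notation cact := (cact G V).
Local Notation cobs := (cobs G V).
Local Notation cereal := (cereal G V).
Local Notation cproc := (cproc G V).
Local Notation cprior := (cprior G V).
Local Notation cfun := (cfun G V).

(** Common domain and codomain of the coded operations, and codomain of the integral, which may be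
    infinite. *)
Definition cereals : V := vset (range cereal).

Lemma vlevel_atom n s : level n (vatom V s).
Proof. by apply: (vlevel_le (leq0n n)); exists s. Qed.

Lemma creal_inj : injective creal.
Proof. by move=> x y /(@vatom_inj _ V)/(@ground_real_inj _ _ _ _ _ G). Qed.

Lemma cparam_inj : injective cparam.
Proof. by move=> x y /(@vatom_inj _ V)/(@ground_param_inj _ _ _ _ _ G). Qed.

Lemma cact_inj : injective cact.
Proof. by move=> x y /(@vatom_inj _ V)/(@ground_act_inj _ _ _ _ _ G). Qed.

Lemma cobs_inj : injective cobs.
Proof. by move=> x y /(@vatom_inj _ V)/(@ground_obs_inj _ _ _ _ _ G). Qed.

Lemma vlevel_cereal x : level 2 (cereal x).
Proof.
have lev0 : level 1 (vset set0) by exact: vlevel_vset.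
case: x => [r||]; first exact: vlevel_atom.
- exact: (vlevel_le (leqnSn 1)).
- by apply: vlevel_vset => _ ->.
Qed.

(** Reals are coded by atoms, and the infinite values by two sets of which only one is empty. *)
Lemma cereal_inj : injective cereal.
Proof.
have sub0 : set0 `<=` level 0 by [].
have sub1 : [set vset set0] `<=` level 1 by move=> _ ->; exact: vlevel_vset.
have N01 : vset set0 <> vset [set vset set0] :> V.
  move=> E; suff /(vmem_vset sub0) : vmem (vset set0) (vset set0 : V) by [].
  by rewrite [in X in vmem _ X]E; apply/(vmem_vset sub1).
move=> [r||] [s||] //= E.
- by rewrite (creal_inj E).
- by case: (vset_natom sub0); rewrite -E; exists (ground_real G r).
- by case: (vset_natom sub1); rewrite -E; exists (ground_real G r).
- by case: (vset_natom sub0); rewrite E; exists (ground_real G s).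
- by case: (vset_natom sub1); rewrite E; exists (ground_real G s).
- by case: N01.
Qed.

Lemma vmem_creals z : vmem z (creals G V) <-> range creal z.
Proof. by apply: (@vmem_vset _ _ 0) => _ [r _ <-]; exact: vlevel_atom. Qed.

Lemma vmem_cparams z : vmem z (cparams G V) <-> range cparam z.
Proof. by apply: (@vmem_vset _ _ 0) => _ [r _ <-]; exact: vlevel_atom. Qed.

Lemma vmem_cereals z : vmem z cereals <-> range cereal z.
Proof. by apply: (@vmem_vset _ _ 2) => _ [r _ <-]; exact: vlevel_cereal. Qed.

Lemma vmem_crel rel x y :
  vmem (vpair (cereal x) (cereal y)) (crel G V rel) <-> rel x y.
Proof.
apply: (iff_trans (@vmem_vset _ _ 4 _ _ _)).
  by move=> _ [a [b [_ ->]]]; apply: vlevel_vpair; exact: vlevel_cereal.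
split=> [[a [b [ab]]]|xy]; last by exists x, y.
by move=> /vpair_inj[/cereal_inj -> /cereal_inj ->].
Qed.

Lemma vmem_cop op x y z :
  vmem (vpair (vpair (cereal x) (cereal y)) z) (cop G V op) <-> z = cereal (op x y).
Proof.
apply: (iff_trans (@vmem_vset _ _ 6 _ _ _)).
  move=> _ [a [b ->]]; apply: vlevel_vpair.
    by apply: vlevel_vpair; exact: vlevel_cereal.
  by apply: (@vlevel_le _ _ 2) => //; exact: vlevel_cereal.
split=> [[a [b]]|->]; last by exists x, y.
by move=> /vpair_inj[/vpair_inj[/cereal_inj -> /cereal_inj ->] ->].
Qed.

Lemma vmem_cdist s t z :
  vmem (vpair (vpair (cparam s) (cparam t)) z) (cdist G V) <-> z = creal (mdist s t).
Proof.
apply: (iff_trans (@vmem_vset _ _ 4 _ _ _)).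
  move=> _ [a [b ->]]; apply: vlevel_vpair; last exact: vlevel_atom.
  by apply: vlevel_vpair; exact: vlevel_atom.
split=> [[a [b]]|->]; last by exists s, t.
by move=> /vpair_inj[/vpair_inj[/cparam_inj -> /cparam_inj ->] ->].
Qed.

Section probability_codes.
Context (d : measure_display) (T : measurableType d) (c : T -> V).
Context (c_inj : injective c) (c_atom : forall t, range (vatom V) (c t)).

Lemma image_vlevel (B : set T) : c @` B `<=` level 0.
Proof. by move=> _ [t _ <-]; exact: c_atom. Qed.

Lemma cprob_vlevel (mu : probability T R) :
  [set vpair (vset (c @` B)) (creal (fine (mu B))) | B in measurable] `<=` level 3.
Proof.
move=> _ [B _ <-]; apply: vlevel_vpair; last exact: vlevel_atom.
exact/vlevel_vset/image_vlevel.
Qed.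

(** Injectivity of [c] recovers an event from its image, so a coded measure has exactly one value at
    each coded measurable set. *)
Lemma vmem_cprob (mu : probability T R) (B : set T) z : measurable B ->
  vmem (vpair (vset (c @` B)) z) (cprob G c mu) <-> z = creal (fine (mu B)).
Proof.
move=> mB; apply: (iff_trans (vmem_vset (@cprob_vlevel mu) _)).
split=> [[B' _ /vpair_inj[/(vset_inj (@image_vlevel _) (@image_vlevel _)) BB' <-]]|->].
  suff -> : B' = B by [].
  by apply/funext => t; rewrite -(image_inj c_inj) BB' (image_inj c_inj).
by exists B.
Qed.

(** The code keeps only the values on measurable sets, which is enough to determine integrals. *)
Lemma cprob_inj (mu nu : probability T R) :
  cprob G c mu = cprob G c nu -> forall B, measurable B -> mu B = nu B.
Proof.
move=> E B mB; have : creal (fine (mu B)) = creal (fine (nu B)).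
  by apply/(vmem_cprob _ _ mB); rewrite -E; apply/vmem_cprob.
move=> /creal_inj fE; rewrite -[mu B]fineK ?fin_num_measure//.
by rewrite -[nu B]fineK ?fin_num_measure// fE.
Qed.

End probability_codes.

Lemma vlevel_cproc delta : level 7 (cproc delta).
Proof.
apply: vlevel_vset => _ [x _ <-]; apply: vlevel_vpair; first exact: vlevel_atom.
by apply/vlevel_vset/cprob_vlevel => a; exists (ground_act G a).
Qed.

Lemma cproc_inj delta delta' : cproc delta = cproc delta' ->
  forall x B, measurable B -> delta x B = delta' x B.
Proof.
have lev (d0 : X -> probability A R) :
    range (fun x => vpair (cobs x) (cprob G cact (d0 x))) `<=` level 6.
  move=> _ [x _ <-]; apply: vlevel_vpair; first exact: vlevel_atom.
  by apply/vlevel_vset/cprob_vlevel => a; exists (ground_act G a).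
move=> /(vset_inj (lev _) (lev _)) E x.
have : range (fun x => vpair (cobs x) (cprob G cact (delta x)))
    (vpair (cobs x) (cprob G cact (delta x))) by exists x.
rewrite E => -[y _ /vpair_inj[/cobs_inj -> /esym]].
by apply: cprob_inj; [exact: cact_inj|move=> a; exists (ground_act G a)].
Qed.

(** Procedures with equal codes may differ off the measurable sets; equality of their risks makes
    the coded risk single-valued. *)
Lemma risk_cproc delta delta' t : cproc delta = cproc delta' ->
  risk pb t delta = risk pb t delta'.
Proof.
move=> /cproc_inj E; apply: eq_integral => x _; apply: eq_measure_integral.
by move=> B mB _; exact: E.
Qed.

Lemma vmem_crisk t delta z : finite_risk pb delta ->
  vmem (vpair (vpair (cparam t) (cproc delta)) z) (crisk pb G V) <->
  z = creal (fine (risk pb t delta)).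
Proof.
(* Codes of procedures lie in level 7, and each of the two nested pairs adds 2. *)
move=> dfin; apply: (iff_trans (@vmem_vset _ _ 11 _ _ _)).
  move=> _ [a [b [_ ->]]]; apply: vlevel_vpair; last exact: vlevel_atom.
  by apply: vlevel_vpair; [exact: vlevel_atom|exact: vlevel_cproc].
split=> [[s [d' [_ /vpair_inj[/vpair_inj[/cparam_inj -> /risk_cproc ->] ->]]]]|->] //.
by exists t, delta.
Qed.

Lemma cfun_vlevel (f : Theta -> R) :
  range (fun t => vpair (cparam t) (creal (f t))) `<=` level 2.
Proof. by move=> _ [t _ <-]; apply: vlevel_vpair; exact: vlevel_atom. Qed.

Lemma vmem_cfun f z :
  vmem z (cfun f) <-> exists t, z = vpair (cparam t) (creal (f t)).
Proof.
apply: (iff_trans (vmem_vset (@cfun_vlevel f) _)).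
by split=> [[t _ <-]|[t ->]]; exists t.
Qed.

Lemma cfun_inj f g : cfun f = cfun g -> f = g.
Proof.
move=> /(vset_inj (@cfun_vlevel f) (@cfun_vlevel g)) E; apply/funext => t.
have : range (fun t => vpair (cparam t) (creal (f t)))
    (vpair (cparam t) (creal (f t))) by exists t.
by rewrite E => -[s _ /vpair_inj[/cparam_inj -> /creal_inj]].
Qed.

Let cparam_atom (t : borel Theta) : range (vatom V) (cparam t).
Proof. by exists (ground_param G t). Qed.

Lemma vlevel_cprior mu : level 4 (cprior mu).
Proof. by apply/vlevel_vset/cprob_vlevel. Qed.

Lemma vmem_cpriors z : vmem z (cpriors G V) <-> range cprior z.
Proof. by apply: (@vmem_vset _ _ 4) => _ [mu _ <-]; exact: vlevel_cprior. Qed.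

Lemma vmem_cprior mu (B : set (borel Theta)) z : measurable B ->
  vmem (vpair (vset (cparam @` B)) z) (cprior mu) <-> z = creal (fine (mu B)).
Proof. by apply: vmem_cprob => //; exact: cparam_inj. Qed.

Lemma vmem_cintegral (f : Theta -> R) mu z :
  (forall t, 0 <= f t) ->
  measurable_fun [set: borel Theta] (f : borel Theta -> R) ->
  vmem (vpair (vpair (cfun f) (cprior mu)) z) (cintegral G V) <->
  z = cereal (\int[mu]_(t in [set: borel Theta]) (f t)%:E)%E.
Proof.
move=> f0 mf; apply: (iff_trans (@vmem_vset _ _ 8 _ _ _)).
  move=> _ [g [nu [_ _ ->]]]; apply: vlevel_vpair; last first.
    by apply: (@vlevel_le _ _ 2) => //; exact: vlevel_cereal.
  apply: vlevel_vpair; last exact: vlevel_cprior.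
  by apply: (@vlevel_le _ _ 3) => //; apply/vlevel_vset/cfun_vlevel.
split=> [[g [nu [_ _]]]|->]; last by exists f, mu.
(* The code determines the function, but the measure only on Borel sets. *)
move=> /vpair_inj[/vpair_inj[/cfun_inj -> E] ->]; congr (cereal _).
apply: eq_measure_integral => B mB _.
by apply/esym; apply: (cprob_inj _ _ E) mB => //; exact: cparam_inj.
Qed.

End coding_theory.

(** * Measurability and the gap between two integrals *)

Section bayes_inequality.
Context (R : realType) (Theta : pmetricType R).

(** Open intervals generate the Borel sets of the reals, and their preimages are open. *)
Lemma continuous_borel (f : Theta -> R) : continuous f ->
  measurable_fun [set: borel Theta] (f : borel Theta -> R).
Proof.
move=> /continuousP cf; apply: (measurability _ (RGenOpens.measurableE R)).
move=> _ [_ [a [b ->] <-]]; rewrite setTI; apply: sub_sigma_algebra.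
exact/cf/interval_open.
Qed.

Lemma mdist_ball_measurable (t0 : Theta) (rho : R) :
  measurable ([set t | mdist t t0 < rho] : set (borel Theta)).
Proof.
apply: sub_sigma_algebra; rewrite /= openE => t /= tt0; apply/nbhs_ballP.
exists (rho - mdist t t0); first by rewrite /= subr_gt0.
move=> u; rewrite ballEmdist /= ltrBrDr metric_sym => ut.
exact: le_lt_trans (metric_triangle _ t _) ut.
Qed.

(** Integrate g + c 1_B <= f, which holds on B by the gap and elsewhere by g <= f. *)
Lemma integral_gap (mu : probability (borel Theta) R) (f g : Theta -> R)
    (B : set (borel Theta)) (c : R) :
  measurable_fun [set: borel Theta] (f : borel Theta -> R) ->
  measurable_fun [set: borel Theta] (g : borel Theta -> R) ->
  measurable B -> (forall t, 0 <= g t <= f t) -> 0 <= c ->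
  (forall t, B t -> g t + c <= f t) ->
  (\int[mu]_(t in [set: borel Theta]) (g t)%:E + c%:E * mu B <=
   \int[mu]_(t in [set: borel Theta]) (f t)%:E)%E.
Proof.
move=> mf mg mB gf c0 gcf.
have mcB : measurable_fun [set: borel Theta] (fun t => c%:E * (\1_B t)%:E)%E.
  apply: (@measurable_funeM _ (borel Theta) R).
  exact/measurable_EFinP/measurable_indic.
have cB0 t : [set: borel Theta] t -> (0 <= c%:E * (\1_B t : R)%:E)%E.
  by move=> _; rewrite -EFinM lee_fin mulr_ge0.
(* With mu(B) as the integral of an indicator, linearity merges the left side into one integral. *)
rewrite -[mu B](_ : \int[mu]_(t in [set: borel Theta]) (\1_B t)%:E = _)%E; last first.
  by rewrite integral_indic// setIT.
rewrite -ge0_integralZl//; last exact/measurable_EFinP/measurable_indic.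
have g0 t : 0 <= g t by have /andP[] := gf t.
rewrite -ge0_integralD//; first last.
- exact/measurable_EFinP.
- by move=> t _; rewrite lee_fin.
apply: ge0_le_integral => //.
- by move=> t tT; rewrite adde_ge0// ?cB0// lee_fin.
- by apply: emeasurable_funD => //; exact/measurable_EFinP.
- exact/measurable_EFinP.
- move=> t _; rewrite -EFinM -EFinD lee_fin indicE.
  have [/set_mem/gcf|_] := boolP (t \in B); first by rewrite mulr1.
  by rewrite mulr0 addr0; have /andP[] := gf t.
Qed.

End bayes_inequality.

(** * Standard facts on risks, balls and priors in coded form *)

Section decision_theory.
Context (R : realType) (Theta : pmetricType R) (dA dX : measure_display)
  (A : measurableType dA) (X : measurableType dX)
  (pb : decision_problem Theta A X).

Lemma risk_ge0 t delta : (0 <= risk pb t delta)%E.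
Proof.
apply: integral_ge0 => x _; apply: integral_ge0 => a _.
by rewrite lee_fin loss_ge0.
Qed.

Lemma risk_fineK delta t : finite_risk pb delta ->
  (fine (risk pb t delta))%:E = risk pb t delta.
Proof. by move=> [_ /(_ t) fin]; rewrite fineK// ge0_fin_numE ?risk_ge0. Qed.

Context (S : Type) (G : ground R Theta A X S) (V : superstructure S).

(** A singleton suffices as second domain, since risks are evaluated at given procedures only. *)
Lemma vfun2_crisk delta : finite_risk pb delta ->
  vfun2 (crisk pb G V) (cparams G V) (vset [set cproc G V delta]) (creals G V).
Proof.
move=> dfin _ /vmem_cparams[t _ <-] _ /vmem_vset1 ->.
exists (creal G V (fine (risk pb t delta))); split; first by apply/vmem_creals; eexists.
by move=> z; exact: vmem_crisk.
Qed.

Lemma is_section_crisk delta : finite_risk pb delta ->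
  is_section (cfun G V (fun t => fine (risk pb t delta))) (crisk pb G V)
    (cparams G V) (cproc G V delta) (creals G V).
Proof.
move=> dfin; split=> [_ /vmem_cparams[t _ <-] r _ /(vmem_crisk _ _ _ dfin) ->|z].
  by apply/vmem_cfun; exists t.
move=> /vmem_cfun[t ->]; exists (cparam G V t); split; first by apply/vmem_cparams; exists t.
eexists; split; last by split=> //; exact/vmem_crisk.
by apply/vmem_creals; eexists.
Qed.

Lemma vfun2_cdist : vfun2 (cdist G V) (cparams G V) (cparams G V) (creals G V).
Proof.
move=> _ /vmem_cparams[s _ <-] _ /vmem_cparams[t _ <-].
exists (creal G V (mdist s t)); split; first by apply/vmem_creals; eexists.
by move=> z; exact: vmem_cdist.
Qed.

Lemma vfun2_cop op : vfun2 (cop G V op) (cereals G V) (cereals G V) (cereals G V).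
Proof.
move=> _ /vmem_cereals[x _ <-] _ /vmem_cereals[y _ <-].
exists (cereal G V (op x y)); split; first by apply/vmem_cereals; eexists.
by move=> z; exact: vmem_cop.
Qed.

Lemma vfun2_cintegral (f : Theta -> R) : (forall t, 0 <= f t) ->
  measurable_fun [set: borel Theta] (f : borel Theta -> R) ->
  vfun2 (cintegral G V) (vset [set cfun G V f]) (cpriors G V) (cereals G V).
Proof.
move=> f0 mf _ /vmem_vset1 -> _ /vmem_cpriors[mu _ <-].
exists (cereal G V (\int[mu]_(t in [set: borel Theta]) (f t)%:E)%E).
split; first by apply/vmem_cereals; eexists.
by move=> z; exact: vmem_cintegral.
Qed.

Definition cball (t0 : Theta) (rho : R) : V :=
  vset (cparam G V @` [set t | mdist t t0 < rho]).

Lemma cball_vlevel (B : set Theta) :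
  cparam G V @` B `<=` vlevel (@vmem S V) (range (vatom V)) 0.
Proof. by move=> _ [t _ <-]; exists (ground_param G t). Qed.

Lemma is_ball_cball t0 rho :
  is_ball (cball t0 rho) (cparams G V) (creals G V) (cdist G V) (cparam G V t0)
    (crel G V (fun a b => (a < b)%E)) (creal G V rho).
Proof.
split=> [z /(vmem_vset (@cball_vlevel _))[t _ <-]|].
  by apply/vmem_cparams; exists t.
move=> _ /vmem_cparams[t _ <-] _ _ /vmem_cdist ->.
have Bt : vmem (cparam G V t) (cball t0 rho) <-> mdist t t0 < rho.
  by rewrite (vmem_vset (@cball_vlevel _)) (image_inj (@cparam_inj _ _ _ _ _ _ _ G V)).
have := @vmem_crel _ _ _ _ _ _ _ G V (fun a b => (a < b)%E) (mdist t t0)%:E rho%:E.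
by rewrite lte_fin /=; tauto.
Qed.

Lemma evaluable_cpriors t0 rho : evaluable (cpriors G V) (cball t0 rho) (creals G V).
Proof.
move=> _ /vmem_cpriors[mu _ <-].
exists (creal G V (fine (mu [set t | mdist t t0 < rho]))).
split; first by apply/vmem_creals; eexists.
by move=> z; apply: vmem_cprior; exact: mdist_ball_measurable.
Qed.

(** For e < c mu(B), the inequality int f <= int g + e would contradict [integral_gap]. *)
Lemma no_bayes_gap (f g : Theta -> R) (t0 : Theta) (rho c : R) :
  measurable_fun [set: borel Theta] (f : borel Theta -> R) ->
  measurable_fun [set: borel Theta] (g : borel Theta -> R) ->
  (forall t, 0 <= g t <= f t) -> 0 <= c ->
  (forall t, mdist t t0 < rho -> g t + c <= f t) ->
  no_bayes (cfun G V f) (cfun G V g) (cball t0 rho) (creal G V c) (cpriors G V)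
    (creals G V) (cereals G V) (cintegral G V) (cop G V (fun a b => (a + b)%E))
    (cop G V (fun a b => (a * b)%E)) (crel G V (fun a b => (a < b)%E))
    (crel G V (fun a b => (a <= b)%E)).
Proof.
move=> mf mg gf c0 gcf.
have g0 t : 0 <= g t by have /andP[] := gf t.
have f0 t : 0 <= f t by have /andP[/le_trans] := gf t; apply.
move=> _ /vmem_cpriors[mu _ <-] _ /vmem_creals[e _ <-] _ /vmem_creals[r0 _ <-].
move=> r1 _ s _ b _ m _ /(vmem_cintegral _ _ _ f0 mf) r0E.
move=> /(vmem_cintegral _ _ _ g0 mg) ->.
move=> /(vmem_cop _ _ _ e%:E) ->.
move=> /(vmem_cprior _ _ _ (mdist_ball_measurable _ _)) ->.
move=> /(vmem_cop _ _ c%:E (fine _)%:E) ->.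
move=> /(vmem_crel _ _ _ e%:E _) em.
move=> /(vmem_crel _ _ _ r0%:E _) r0s.
have {}r0E := cereal_inj (r0E : cereal G V r0%:E = _).
have := integral_gap mu mf mg (mdist_ball_measurable t0 rho) gf c0 gcf.
move: r0s em; rewrite -r0E -[mu _]fineK ?fin_num_measure//; last exact: mdist_ball_measurable.
(* Only a finite integral of g needs arithmetic: +oo violates the gap inequality, whose right side
   is the real [r0], and -oo violates r0 <= int g + e. *)
case: (integral _ _ _) => [r||] //=.
rewrite -EFinM -!EFinD !lee_fin lte_fin => *; lra.
Qed.

End decision_theory.

(** * Nonstandard notions as extensions of standard codes *)

Section nonstandard_values.
Context (R : realType) (Theta : pmetricType R) (dA dX : measure_display)
  (A : measurableType dA) (X : measurableType dX)
  (pb : decision_problem Theta A X)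
  (S K : Type) (G : ground R Theta A X S) (E : nonstandard_extension S K).

Lemma ns_real_cereals x : ns_real G x -> vmem x (star (cereals G (stdv E))).
Proof.
apply: star_subset => z /vmem_creals[r _ <-].
by apply/vmem_cereals; exists r%:E.
Qed.

Lemma ns_real_std (r : R) : ns_real G (ns_std G E r).
Proof. by apply/star_mem/vmem_creals; exists r. Qed.

Lemma ns_lt_std (r s : R) : ns_lt G (ns_std G E r) (ns_std G E s) <-> r < s.
Proof.
rewrite /ns_lt -star_vpair -star_mem.
by rewrite (vmem_crel G (stdv E) (fun a b => (a < b)%E) r%:E s%:E) lte_fin.
Qed.

Lemma ns_std_not_infinitesimal (r : R) : 0 < r -> ~ ns_infinitesimal G (ns_std G E r).
Proof. by move=> r0 [_ /(_ r r0)[_ /ns_lt_std]]; rewrite ltxx. Qed.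

(** The graph in [ns_bayes_risk] is formed by external comprehension. Being the extension of a coded
    risk function, it is internal, and the transferred facts on integrals apply to it. *)
Lemma ns_risk_graph delta : finite_risk pb delta ->
  vgraph [set t | ns_param G t] (fun t => ns_risk pb G t (star_proc G E delta)) =
  star (cfun G (stdv E) (fun t => fine (risk pb t delta))).
Proof.
move=> dfin; apply: vset_ext.
  by apply: star_natom; exact/vset_natom/cfun_vlevel.
have dd : vmem (star_proc G E delta) (star (vset [set cproc G (stdv E) delta])).
  by apply/star_mem/vmem_vset1.
have [gr rg] := star_section (is_section_crisk G (stdv E) dfin).
have val t (tP : ns_param G t) :=
  vfun2_vapp (star_vfun2 (vfun2_crisk (G := G) (V := stdv E) dfin)) tP dd.
move=> z; split=> [/rg[t [tP [r [rR [-> tr]]]]]|[t tP <-]].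
  by exists t => //; congr (vpair _ _); exact/esym/(val t tP).2.
by have [rR tr] := val t tP; apply: gr => //; apply/tr.
Qed.

(** With standard centre and radius the ball is the extension of a standard Borel set, hence an
    event that a nonstandard prior evaluates. *)
Lemma ns_ballE (t0 : Theta) (rho : R) :
  ns_ball G (star (cparam G (stdv E) t0)) (ns_std G E rho) =
  star (cball G (stdv E) t0 rho).
Proof.
apply: vset_ext; first by apply: star_natom; exact/vset_natom/cball_vlevel.
have [BP Bd] := star_ball (is_ball_cball G (stdv E) t0 rho).
have t0P : vmem (star (cparam G (stdv E) t0)) (star (cparams G (stdv E))).
  by apply/star_mem/vmem_cparams; exists t0.
have val t (tP : ns_param G t) :=
  vfun2_vapp (star_vfun2 (vfun2_cdist (G := G) (V := stdv E))) tP t0P.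
have Bt t (tP : vmem t (star (cparams G (stdv E)))) :
    vmem t (star (cball G (stdv E) t0 rho)) <->
    ns_lt G (ns_dist G t (star (cparam G (stdv E) t0))) (ns_std G E rho).
  have [dR tt0] := val t tP.
  by have [] := Bd t tP _ dR ((tt0 _).2 erefl).
move=> t; split=> [tB|[tP /Bt]]; last exact.
by have tP := BP t tB; split=> //; apply/Bt.
Qed.

End nonstandard_values.

(** * Domination refutes the nonstandard Bayes property *)

Theorem theorem7p5 (R : realType) (Theta : pmetricType R)
    (dA dX : measure_display) (A : measurableType dA) (X : measurableType dX)
    (pb : decision_problem Theta A X)
    (S : Type) (G : ground R Theta A X S)
    (K : Type) (E : nonstandard_extension S K)
    (risk_continuous : forall delta, finite_risk pb delta ->
       continuous (fun t : Theta => fine (risk pb t delta) : R))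
    (delta0 : X -> probability A R) (delta0_fin : finite_risk pb delta0)
    (C : set (X -> probability A R)) (C_fin : C `<=` finite_risk pb) :
  (exists eps : nsv E,
     [/\ ns_real G eps, ns_lt G (ns_std G E 0) eps &
       exists Pi : nsv E,
         [/\ ns_prior G Pi, ns_regular G eps Pi &
           ns_bayes pb G eps [set star_proc G E delta | delta in C] Pi
             (star_proc G E delta0)]]) ->
  admissible pb C delta0.
Proof.
move=> [eps [epsR _ [Pi [PiQ reg [_ bayesR bayes]]]]] [delta [Cd dle [t0 dt0]]].
have dfin := C_fin _ Cd.
pose f t : R := fine (risk pb t delta0); pose g t : R := fine (risk pb t delta).
have cf : continuous f := risk_continuous _ delta0_fin.
have cg : continuous g := risk_continuous _ dfin.
have mf := continuous_borel cf; have mg := continuous_borel cg.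
have g0 t : 0 <= g t by rewrite fine_ge0 ?risk_ge0.
have gf t : g t <= f t by rewrite -lee_fin !risk_fineK.
have f0 t : 0 <= f t := le_trans (g0 t) (gf t).
have gf0 : g t0 < f t0.
  by rewrite -lte_fin !risk_fineK// lt_neqAle dt0 dle.
(* Half the gap at [t0] leaves a strict inequality, which continuity of f - g spreads to a ball. *)
pose c := (f t0 - g t0) / 2; have c0 : 0 < c by rewrite divr_gt0// subr_gt0.
have [rho rho0 gcf] : exists2 rho, 0 < rho & forall t, mdist t t0 < rho -> g t + c <= f t.
  have : \forall t \near t0, c < f t - g t.
    by apply: (cvgr_gt _ (cvgB (cf t0) (cg t0))); rewrite /c; lra.
  move/nbhs_ballP => [rho /= rho0 H]; exists rho => // t.
  rewrite metric_sym => tt0; have /= : c < f t - g t by apply: H; rewrite ballEmdist.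
  by move=> ?; lra.
(* Transfer with f, g, the ball and c fixed gives a statement about all internal priors and all
   nonstandard reals e. *)
have key := star_no_bayes (no_bayes_gap (G := G) (V := stdv E) mf mg
  (fun t => introT andP (conj (g0 t) (gf t))) (ltW c0) gcf).
(* The internal integral of the extension of [h] against [Pi] is a well-determined extended
   nonstandard real. *)
have intval (h : Theta -> R) (h0 : forall t, 0 <= h t)
    (mh : measurable_fun [set: borel Theta] (h : borel Theta -> R)) :=
  vfun2_vapp (star_vfun2 (vfun2_cintegral (G := G) (V := stdv E) h0 mh))
  (proj1 (star_mem _ _) (proj2 (vmem_vset1 _ _) erefl)) PiQ.
have opval op x y xR yR :=
  @vfun2_vapp _ _ _ _ _ _ x y (star_vfun2 (vfun2_cop (G := G) (V := stdv E) op)) xR yR.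
have [b [bR bP]] := star_evaluable (evaluable_cpriors (G := G) (V := stdv E) t0 rho) PiQ.
have rhoN : ~ ns_infinitesimal G (ns_std G E rho) := ns_std_not_infinitesimal rho0.
(* Regularity at the standard radius [rho], which is not infinitesimal, and the standard factor
   [c]. *)
have := reg t0 _ (ns_real_std G E rho) (proj2 (ns_lt_std G E 0 rho) rho0) rhoN _ c0.
rewrite ns_ballE (_ : vapp Pi _ = b); last first.
  by apply/bP; apply: (@vapp_mem _ _ _ _ b); apply/bP.
have := bayes _ (ex_intro2 _ _ delta Cd erefl).
move: bayesR; rewrite /ns_bayes_risk !ns_risk_graph//.
have [_ If] := intval f f0 mf; have [IgE Ig] := intval g g0 mg => IfR.
have [sE sP] := opval (fun a b => a + b)%E _ _ IgE (ns_real_cereals epsR).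
have [mE mP] := opval (fun a b => a * b)%E _ _ (ns_real_cereals (ns_real_std G E c))
  (ns_real_cereals bR).
move=> le lt.
(* [le] is the Bayes inequality against [delta] and [lt] says eps < c b, which [key] excludes
   together. The goals left say that the named values are results of the internal operations. *)
by apply: (key Pi PiQ eps epsR _ IfR _ IgE _ sE b bR _ mE) => //;
  [apply/If|apply/Ig|apply/sP|apply/bP|apply/mP].
Qed.
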